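(* Let $(E,\mathcal E,\mu)$ be a measure space and let $\mathcal E'\subseteq\mathcal E$ be arbitrary. Then $\widetilde{\mathcal E'}$ is separable in $(\widetilde{\mathcal E},d_\mu)$ if and only if there exists a filtration $\mathcal F=(\mathcal F_n)_{n\in\mathbb N}$, with $|\mathcal F_n|$ finite for each $n\in\mathbb N$, such that $\mu$ is approximable on $\mathcal E'$ with respect to $\mathcal F$.
   Context: The measure $\mu$ is arbitrary (possibly infinite). For $A\in\mathcal E$ let $[A]=\{B\in\mathcal E:\mu(A\Delta B)=0\}$, where $\Delta$ is symmetric difference, and $\widetilde{\mathcal E}=\{[A]:A\in\mathcal E\}$. For $\mathcal E'\subseteq\mathcal E$ put $\widetilde{\mathcal E'}=\{[A]:A\in\mathcal E'\}$. The metric, possibly taking the value $\infty$, is $d_\mu([A],[B])=\mu(A\Delta B)^{1/2}$ on $\widetilde{\mathcal E}$, and $\widetilde{\mathcal E}$ carries the topology generated by $d_\mu$. A space is separable if it contains a countable dense subset; ''$\widetilde{\mathcal E'}$ is separable in $(\widetilde{\mathcal E},d_\mu)$'' refers to $\widetilde{\mathcal E'}$ as a subspace. A filtration is a sequence $\mathcal F=(\mathcal F_n)_{n\in\mathbb N}$ of $\sigma$-algebras on $E$ with $\mathcal F_n\subseteq\mathcal E$ and $\mathcal F_n\subseteq\mathcal F_{n+1}$ for all $n$. The measure $\mu$ is approximable on $\mathcal E'$ with respect to $\mathcal F$ if for each $A\in\mathcal E'$ and each $\epsilon>0$ there exist $n_\epsilon\in\mathbb N$ and $A'\in\mathcal F_{n_\epsilon}$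 such that $\mu(A\Delta A')<\epsilon$. *)

(* Defs.v *)
From HB Require Import structures.
From mathcomp Require Import all_boot all_order all_algebra.
From mathcomp Require Import all_classical all_reals all_analysis.

Set Implicit Arguments.
Unset Strict Implicit.
Unset Printing Implicit Defensive.

Import Order.TTheory GRing.Theory Num.Theory.

Local Open Scope classical_set_scope.
Local Open Scope ring_scope.
Local Open Scope ereal_scope.

Section symmetric_difference.
Context (R : realType) (d : measure_display) (T : measurableType d).
Variable mu : {measure set T -> \bar R}.
Implicit Types A B C : set T.

Lemma measurable_symdiff A B :
  measurable A -> measurable B -> measurable (A `+` B).
Proof. by move=> mA mB; apply: measurableU; exact: measurableD. Qed.

Lemma measure_symdiff_triangle B A C :
  measurable A -> measurable B -> measurable C ->
  mu (A `+` C) <= mu (A `+` B) + mu (B `+` C).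
Proof.
move=> mA mB mC.
have mAB := measurable_symdiff mA mB; have mBC := measurable_symdiff mB mC.
apply: (@le_trans _ _ (mu ((A `+` B) `|` (B `+` C)))); last exact: measureU2.
apply: le_measure; rewrite ?inE; [exact: measurable_symdiff|exact: measurableU|].
move=> x [[Ax nCx]|[Cx nAx]]; have [Bx|nBx] := pselect (B x).
- by right; left.
- by left; left.
- by left; right.
- by right; right.
Qed.

Lemma measure_symdiff_congr A A' B B' :
  measurable A -> measurable A' -> measurable B -> measurable B' ->
  mu (A `+` A') = 0 -> mu (B `+` B') = 0 -> mu (A `+` B) = mu (A' `+` B').
Proof.
move=> mA mA' mB mB' AA' BB'; apply/eqP; rewrite eq_le; apply/andP; split.
  apply: (le_trans (measure_symdiff_triangle mA mA' mB)).
  rewrite AA' add0e; apply: (le_trans (measure_symdiff_triangle mA' mB' mB)).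
  by rewrite (setYC B') BB' adde0.
apply: (le_trans (measure_symdiff_triangle mA' mA mB')).
rewrite (setYC A') AA' add0e.
by apply: (le_trans (measure_symdiff_triangle mA mB mB')); rewrite BB' adde0.
Qed.

End symmetric_difference.

Section measure_algebra.
Context (R : realType) (d : measure_display) (T : measurableType d).
Variable mu : {measure set T -> \bar R}.

Definition mclass (A : set T) : set (set T) :=
  [set B | measurable B /\ mu (A `+` B) = 0].

Definition malgebra : Type :=
  {c : set (set T) | exists2 A, measurable A & c = mclass A}.

HB.instance Definition _ := gen_eqMixin malgebra.
HB.instance Definition _ := gen_choiceMixin malgebra.

Definition mclasses (E' : set (set T)) : set malgebra :=
  [set c | exists2 A, E' A & sval c = mclass A].

Definition mrepr (c : malgebra) : set T := sval (cid2 (svalP c)).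

(* independent of the representatives: see dmuE *)
Definition dmu (a b : malgebra) : \bar R := sqrte (mu (mrepr a `+` mrepr b)).

Lemma measurable_mrepr c : measurable (mrepr c).
Proof. by rewrite /mrepr; case: cid2. Qed.

Lemma mclass_mrepr c : mclass (mrepr c) = sval c.
Proof. by rewrite /mrepr; case: cid2. Qed.

Lemma mclassP A B : measurable A -> measurable B ->
  mclass A = mclass B <-> mu (A `+` B) = 0.
Proof.
move=> mA mB; split=> [AB|AB].
  have [] : mclass A B by rewrite AB; split => //; rewrite setYK measure0.
  by [].
have AA : mu (A `+` A) = 0 by rewrite setYK measure0.
apply/seteqP; split=> C [mC eC]; split => //; rewrite -eC.
  by apply: measure_symdiff_congr => //; rewrite ?setYK ?measure0// setYC.
by apply: measure_symdiff_congr => //; rewrite ?setYK ?measure0.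
Qed.

Lemma dmuE (a b : malgebra) (A B : set T) : measurable A -> measurable B ->
  sval a = mclass A -> sval b = mclass B -> dmu a b = sqrte (mu (A `+` B)).
Proof.
move=> mA mB; rewrite -!mclass_mrepr => /mclassP aA /mclassP bB.
have ma := measurable_mrepr a; have mb := measurable_mrepr b.
by congr sqrte; apply: measure_symdiff_congr => //; [exact: aA|exact: bB].
Qed.

Lemma dmuxx a : dmu a a = 0.
Proof. by rewrite /dmu setYK measure0 sqrte0. Qed.

Lemma dmu_sym a b : dmu a b = dmu b a.
Proof. by rewrite /dmu setYC. Qed.

Lemma dmu_eq0 a b : dmu a b = 0 -> a = b.
Proof.
have ma := measurable_mrepr a; have mb := measurable_mrepr b.
move=> /(congr1 (fun x => x ^+ 2)); rewrite sqr_sqrte// expe2 mule0 => ab0.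
apply: eq_sig_hprop => [c p q|]; first exact: Prop_irrelevance.
by rewrite -/(sval a) -!mclass_mrepr; apply/mclassP.
Qed.

Lemma sqrteD_le (x y : \bar R) : 0 <= x -> 0 <= y ->
  sqrte (x + y) <= sqrte x + sqrte y.
Proof.
move: x y => [x| |] [y| |] //= x0 y0.
rewrite !lee_fin in x0 y0 *.
have sxy := addr_ge0 (sqrtr_ge0 x) (sqrtr_ge0 y).
rewrite -[leRHS]ger0_norm// -sqrtr_sqr ler_wsqrtr// sqrrD !sqr_sqrtr//.
by rewrite addrAC lerDl mulrn_wge0// mulr_ge0// sqrtr_ge0.
Qed.

Lemma dmu_triangle b a c : dmu a c <= dmu a b + dmu b c.
Proof.
have ma := measurable_mrepr a; have mb := measurable_mrepr b.
have mc := measurable_mrepr c.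
apply: le_trans (sqrteD_le _ _) => //.
by rewrite lee_sqrt ?adde_ge0//; exact: measure_symdiff_triangle.
Qed.

(* The distance dmu may be infinite, so that there is no metricType structure;
   the balls of dmu nevertheless define a pseudoMetricType, hence a topology. *)
Definition dmu_ball (a : malgebra) (e : R) : set malgebra :=
  [set b | dmu a b < e%:E].

Let dmu_nbhs (a : malgebra) : set_system malgebra :=
  nbhs_ (entourage_ dmu_ball) a.

HB.instance Definition _ := hasNbhs.Build malgebra dmu_nbhs.

Let dmu_nbhsE : nbhs = nbhs_ (entourage_ dmu_ball). Proof. by []. Qed.

Let dmu_ball_center a (e : R) : (0 < e)%R -> dmu_ball a e a.
Proof. by move=> e0; rewrite /dmu_ball/= dmuxx lte_fin. Qed.

Let dmu_ball_sym a b (e : R) : dmu_ball a e b -> dmu_ball b e a.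
Proof. by rewrite /dmu_ball/= dmu_sym. Qed.

Let dmu_ball_triangle a b c (e1 e2 : R) :
  dmu_ball a e1 b -> dmu_ball b e2 c -> dmu_ball a (e1 + e2)%R c.
Proof.
rewrite /dmu_ball/= EFinD => ab bc; apply: le_lt_trans (dmu_triangle b a c) _.
exact: lteD.
Qed.

HB.instance Definition _ := Nbhs_isPseudoMetric.Build R malgebra
  dmu_nbhsE dmu_ball_center dmu_ball_sym dmu_ball_triangle erefl.

Lemma open_dmuP (U : set malgebra) :
  open U <-> forall a, U a -> exists2 e : R, (0 < e)%R & dmu_ball a e `<=` U.
Proof.
by rewrite openE /interior; split=> oU a /oU; rewrite -nbhs_ballE.
Qed.

End measure_algebra.

Arguments mclasses {R d T} mu E'.

Definition separable (X : topologicalType) : Prop :=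
  exists2 D : set X, countable D & dense D.

Definition is_filtration (d : measure_display) (T : measurableType d)
    (F : nat -> set (set T)) : Prop :=
  [/\ forall n, sigma_algebra [set: T] (F n),
      forall n, F n `<=` measurable &
      forall n, F n `<=` F n.+1].

Definition approximable (R : realType) (d : measure_display)
    (T : measurableType d) (mu : {measure set T -> \bar R})
    (E' : set (set T)) (F : nat -> set (set T)) : Prop :=
  forall A, E' A -> forall eps : R, (0 < eps)%R ->
    exists n, exists2 A', F n A' & mu (A `+` A') < eps%:E.

(* Main.v *)
Require Import Defs.
From HB Require Import structures.
From mathcomp Require Import all_boot all_order all_algebra.
From mathcomp Require Import all_classical all_reals all_analysis.

Local Open Scope classical_set_scope.
Local Open Scope ring_scope.

(** Both conditions say that E' is approximated, in the sense of mu of the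
    symmetric difference, by a sequence of measurable sets g_0, g_1, ... .
    From a filtration of finite sigma-algebras one enumerates the union of its
    terms; from a sequence (g_n) one lets F_n be the finite sigma-algebra of
    the unions of atoms of g_0, ..., g_(n-1). As the g_n need not lie in E',
    separability of the subspace is recovered by choosing, for all n and k, a
    class of E' at distance less than 1/(k+1) from g_n if there is one. *)

Import Order.TTheory GRing.Theory Num.Theory.

(** The default [x0] fills the indices that the injection of [C] into [nat] misses, so that [C] may
    be finite or empty. *)
Lemma countable_enum {T : choiceType} (x0 : T) {C : set T} : countable C ->
  exists2 g : nat -> T, (forall n, g n = x0 \/ C (g n)) &
    forall x, C x -> exists n, g n = x.
Proof.
move=> /countable_injP[f finj].
exists (fun n => xget x0 (C `&` f @^-1` [set n])) => [n|x Cx].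
  by case: xgetP => [y _ [Cy _]|_]; [right|left].
exists (f x); case: xgetP => [y -> /= [Cy fyx]|/(_ x)[]//].
by apply: finj; rewrite ?inE.
Qed.

Lemma dense_nbhs {X : topologicalType} {D U : set X} {x : X} :
  dense D -> nbhs x U -> exists2 y, D y & U y.
Proof.
move=> dD; rewrite nbhsE => -[V [oV Vx] VU].
by have [y [/VU Uy Dy]] := dD V (ex_intro _ x Vx) oV; exists y.
Qed.

(** These are the unions of fibres of [f]. For [f := atom g n] they form the sigma-algebra generated
    by the first [n] sets of [g]. *)
Definition saturated {T U : Type} (f : T -> U) : set (set T) :=
  [set A | forall x y, f x = f y -> A x -> A y].

Lemma sigma_algebra_saturated (T U : Type) (f : T -> U) :
  sigma_algebra [set: T] (saturated f).
Proof.
split=> [x y _ []|A sA x y fxy [_ nAx]|A sA x y fxy [n _ Anx]].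
- by split=> // Ay; apply: nAx; exact: sA Ay.
- by exists n => //; exact: sA Anx.
Qed.

Lemma saturated_preimage (T U : Type) (f : T -> U) (A : set T) :
  saturated f A -> A = f @^-1` (f @` A).
Proof.
move=> sA; apply/seteqP; split=> [|x [y Ay fyx]]; first exact: preimage_image.
exact: sA Ay.
Qed.

(** A saturated set is the preimage of its image, and [U] has finitely many subsets. *)
Lemma finite_saturated (T : Type) (U : finType) (f : T -> U) :
  finite_set (saturated f).
Proof.
pose pre (S : {set U}) : set T := f @^-1` [set` S].
apply: (@sub_finite_set _ _ (range pre)); last first.
  by apply: finite_image; exact: finite_finset.
move=> A /saturated_preimage ->.
exists [set u : U | `[< (f @` A) u >]]%SET => //.
by apply/seteqP; split=> x; rewrite /pre/= inE => /asboolP.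
Qed.

Lemma measurable_saturated (d : measure_display) (T : measurableType d)
    (U : finType) (f : T -> U) :
  (forall u, measurable (f @^-1` [set u])) -> saturated f `<=` measurable.
Proof.
move=> mf A /saturated_preimage ->.
rewrite (_ : _ @^-1` _ = \bigcup_(u in f @` A) f @^-1` [set u]); last first.
  by apply/seteqP; split=> [x Afx|x [_ Au /= ->]//]; exists (f x).
by apply: fin_bigcup_measurable => //; exact: finite_finset.
Qed.

Definition atom {T : Type} (g : nat -> set T) (n : nat) (x : T) :
    {ffun 'I_n -> bool} :=
  [ffun i : 'I_n => `[< g i x >]].

(** [atom g n] records only the indices below [n], so [g n] first becomes saturated at stage
    [n.+1]. *)
Lemma saturated_atom (T : Type) (g : nat -> set T) (n : nat) :
  saturated (atom g n.+1) (g n).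
Proof.
move=> x y /ffunP/(_ ord_max); rewrite !ffunE => gxy gx.
by apply/asboolP; rewrite -gxy; exact/asboolP.
Qed.

Lemma is_filtration_atom (d : measure_display) (T : measurableType d)
    (g : nat -> set T) : (forall n, measurable (g n)) ->
  is_filtration (fun n => saturated (atom g n)).
Proof.
move=> mg; split=> [n|n|n A sA x y xy].
- exact: sigma_algebra_saturated.
- apply: measurable_saturated => u.
  (* The fibre over [u] is a finite intersection of sets [g i] and complements, selected by the bits
     of [u]. *)
  rewrite (_ : _ @^-1` _ =
    \bigcap_(i in [set: 'I_n]) (if u i then g i else ~` g i)); last first.
    apply/seteqP; split=> [x <- i _|x gx]; first by rewrite ffunE; case: asboolP.
    apply/ffunP => i; rewrite ffunE.
    by move: (gx i Logic.I); case: (u i) => gix; [exact/asboolT|exact/asboolF].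
  apply: fin_bigcap_measurable; first exact: finite_finset.
  by move=> i _; case: (u i) => //; exact: measurableC.
(* [atom g n] is a restriction of [atom g n.+1], so the fibres can only get finer. *)
- apply: sA; apply/ffunP => i; move/ffunP/(_ (widen_ord (leqnSn n) i)): xy.
  by rewrite !ffunE.
Qed.

Section separability.
Context {R : realType} {d : measure_display} {T : measurableType d}.
Variable mu : {measure set T -> \bar R}.

(** Squaring removes the root from [dmu], so that later estimates can use the triangle inequality of
    [mu] itself. *)
Lemma dmu_ballE (a b : malgebra mu) {e : R} : 0 < e ->
  dmu_ball a e b <-> (mu (mrepr a `+` mrepr b) < (e ^+ 2)%:E)%E.
Proof.
move=> e0; rewrite /dmu_ball/= /dmu.
have -> : e%:E = sqrte (e ^+ 2)%:E by rewrite /= sqrtr_sqr gtr0_norm.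
by rewrite !ltNge lee_sqrt.
Qed.

Lemma mu_symdiff_mrepr {a : malgebra mu} {A B : set T} :
  measurable A -> measurable B -> sval a = mclass mu A ->
  mu (A `+` B) = mu (mrepr a `+` B).
Proof.
move=> mA mB; rewrite -mclass_mrepr => /esym/mclassP aA.
have ma := measurable_mrepr a.
by apply: measure_symdiff_congr; rewrite ?setYK ?measure0//; exact: aA.
Qed.

Definition countably_approximable (E' : set (set T)) : Prop :=
  exists2 g : nat -> set T, (forall n, measurable (g n)) &
    forall A, E' A -> forall eps : R, 0 < eps ->
      exists n, (mu (A `+` g n) < eps%:E)%E.

Lemma separable_countably_approximable (E' : set (set T)) :
  E' `<=` measurable ->
  separable (mclasses mu E') -> countably_approximable E'.
Proof.
move=> mE' [D cD dD].
pose C := [set mrepr (set_val y) | y in D].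
have cC : countable C by exact: sub_countable (card_image_le _ _) cD.
have [g gC Cg] := countable_enum set0 cC.
exists g => [n|A E'A e e0].
  by have [->//|[y _ <-]] := gC n; exact: measurable_mrepr.
have aP : exists2 B, measurable B & mclass mu A = mclass mu B.
  by exists A => //; exact: mE'.
pose a : malgebra mu := exist _ (mclass mu A) aP.
have aE' : a \in mclasses mu E' by rewrite inE; exists A.
pose a' : mclasses mu E' := exist _ a aE'.
(* A ball of radius [Num.sqrt e] for [dmu] bounds the measure by [e]. *)
have se0 : 0 < Num.sqrt e by rewrite sqrtr_gt0.
have [y Dy] := dense_nbhs dD (nbhsx_ballx a' _ se0).
move=> /(dmu_ballE a (set_val y) se0); rewrite sqr_sqrtr ?ltW// => ay.
have [n gn] : exists n, g n = mrepr (set_val y) by apply: Cg; exists y.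
exists n; rewrite gn (@mu_symdiff_mrepr a)//; first exact: mE'.
exact: measurable_mrepr.
Qed.

Lemma countably_approximable_separable (E' : set (set T)) :
  E' `<=` measurable ->
  countably_approximable E' -> separable (mclasses mu E').
Proof.
move=> mE' [g mg gE'].
(* If the subspace is empty, there is no default point for [xget], but [set0] is then dense. *)
have [[x0 _]|noE'] := pselect (exists x : mclasses mu E', True); last first.
  by exists set0 => // O [x _]; case: noE'; exists x.
pose P n k : set (mclasses mu E') :=
  [set y | (mu (mrepr (set_val y) `+` g n) < (k.+1%:R^-1)%:E)%E].
pose y (nk : nat * nat) := xget x0 (P nk.1 nk.2).
exists (range y).
  by apply: sub_countable (card_image_le _ _) _; exact: countableP.
move=> O [x Ox] oO.
have /nbhs_ballP[e /= e0 xeO] : nbhs x O by exact: open_nbhs_nbhs.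
(* Two errors, from [x] to [g n] and from [g n] to the chosen point, must add up to less than
   [e ^+ 2]. *)
have e20 : 0 < e ^+ 2 / 2 by rewrite divr_gt0// exprn_gt0.
have [k _ /(_ k (leqnn k)) /= ke] := near_infty_natSinv_lt (PosNum e20).
have [A E'A xA] : mclasses mu E' (set_val x) by exact/set_mem/(valP x).
have [n] := gE' A E'A k.+1%:R^-1 ltac:(by rewrite invr_gt0).
rewrite (mu_symdiff_mrepr (mE' A E'A) (mg n) xA).
move=> xn; exists (y (n, k)); split; last by exists (n, k).
(* The point [x] itself lies in [P n k], so [xget] does not fall back on [x0]. *)
have yn : P n k (y (n, k)) by rewrite /y/=; case: xgetP => [//|/(_ x)].
apply: xeO; apply/(dmu_ballE (set_val x) (set_val (y (n, k))) e0).
apply: (le_lt_trans (measure_symdiff_triangle mu (measurable_mrepr _) (mg n)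
  (measurable_mrepr _))).
rewrite (splitr (e ^+ 2)) EFinD; apply: lteD.
  by apply: lt_trans xn _; rewrite lte_fin.
by rewrite setYC; apply: lt_trans yn _; rewrite lte_fin.
Qed.

Lemma countably_approximable_filtration (E' : set (set T)) :
  countably_approximable E' <->
  exists F : nat -> set (set T),
    [/\ is_filtration F, forall n, finite_set (F n) & approximable mu E' F].
Proof.
split=> [[g mg gE']|[F [[_ mF _] finF FE']]].
  exists (fun n => saturated (atom g n)); split.
  - exact: is_filtration_atom.
  - by move=> n; exact: finite_saturated.
  - move=> A E'A e e0; have [n An] := gE' A E'A e e0.
    by exists n.+1, (g n) => //; exact: saturated_atom.
have cF : countable (\bigcup_n F n).
  by apply: bigcup_countable => // n _; exact: finite_set_countable.
(* The default [set0] keeps every term of the enumeration measurable. *)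
have [g gF Fg] := countable_enum set0 cF.
exists g => [n|A E'A e e0].
  by have [->//|[k _ /mF]] := gF n.
have [k [B FB AB]] := FE' A E'A e e0.
by have [n gn] : exists n, g n = B by [apply: Fg; exists k]; exists n; rewrite gn.
Qed.

End separability.

(* [mclasses mu E'], coerced to a type, carries the topology induced by that of
   the space [malgebra mu] of all classes. *)
Theorem theorem3p1 (R : realType) (d : measure_display) (T : measurableType d)
    (mu : {measure set T -> \bar R}) (E' : set (set T))
    (mE' : E' `<=` measurable) :
  separable (mclasses mu E') <->
  exists F : nat -> set (set T),
    [/\ is_filtration F, forall n, finite_set (F n) & approximable mu E' F].
Proof.
rewrite -countably_approximable_filtration; split.
- exact: separable_countably_approximable.
- exact: countably_approximable_separable.
Qed.
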